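(* Let $I=[a,b]$ be a compact interval, let $(X,d)$ be a complete metric space, let $g:I\to\mathbb R$ be left-continuous and nondecreasing, let $\alpha>1$, and let $F:I\to\mathcal K(X)$ be $g$-Hölder of exponent $\alpha$. Fix $\theta\in I$ and $x_\theta\in F(\theta)$, and let $f:I\to X$ be a selection of $F$ with $f(\theta)=x_\theta$ such that, for every $a\le s<t\le b$, $$d(f(s),f(t))\le V_H(F;[s,t])\le[F]_{\alpha,g}|g(t)-g(s)|^\alpha\quad\text{and}\quad V(f;[s,t])\le V_H(F;[s,t]).$$ Then, for every $a\le\tau<b$, $$J_f(\tau)\le J_F(\tau)\le[F]_{\alpha,g}[\Delta^+g(\tau)]^\alpha.$$ Consequently, if $$\mathcal J(g)=\{\tau<b:\Delta^+g(\tau)>0\},\quad \mathcal J(F)=\{\tau<b:F(\tau+)\ne F(\tau)\},\quad \mathcal J(f)=\{\tau<b:f(\tau+)\ne f(\tau)\}$$ (with $\tau$ ranging over $[a,b)$), then $\mathcal J(f)\subseteq\mathcal J(F)\subseteq\mathcal J(g)$.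
   Context: $\mathcal K(X)$ is the family of all nonempty compact subsets of $X$ with Hausdorff distance $d_H$. A selection of $F$ is a map $f:I\to X$ with $f(t)\in F(t)$ for all $t\in I$. $F$ is $g$-Hölder of exponent $\alpha$ if there is $L\ge0$ with $d_H(F(s),F(t))\le L|g(t)-g(s)|^\alpha$ for all $s,t\in I$; $[F]_{\alpha,g}$ is the minimum such $L$. $V_H(F;[s,t])=\sup_P\sum_{i=1}^n d_H(F(t_{i-1}),F(t_i))$ and $V(f;[s,t])=\sup_P\sum_{i=1}^n d(f(t_{i-1}),f(t_i))$ over all finite partitions $P:s=t_0<\cdots<t_n=t$. For $\tau\in[a,b)$: $\Delta^+g(\tau)=g(\tau+)-g(\tau)$ with $g(\tau+)=\lim_{r\downarrow\tau}g(r)$; $F(\tau+)=\lim_{r\downarrow\tau}F(r)$ in $(\mathcal K(X),d_H)$ and $f(\tau+)=\lim_{r\downarrow\tau}f(r)$ in $X$ (under the stated hypotheses these limits exist for every $\tau\in[a,b)$); $J_F(\tau)=d_H(F(\tau+),F(\tau))$ and $J_f(\tau)=d(f(\tau+),f(\tau))$. *)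

(* Defs.v *)
From HB Require Import structures.
From mathcomp Require Import all_boot all_order all_algebra.
From mathcomp Require Import all_classical all_reals all_analysis.

Set Implicit Arguments.
Unset Strict Implicit.
Unset Printing Implicit Defensive.
Import Order.TTheory GRing.Theory Num.Theory.
Import numFieldNormedType.Exports.

Local Open Scope classical_set_scope.
Local Open Scope ring_scope.

(* Points are required only because [lim] and the library's [completeType] are
   defined on pointed types. *)
#[short(type="pmetricType")]
HB.structure Definition PointedMetric (K : numDomainType) :=
  {M of Metric K M & isPointed M}.

#[short(type="completeMetricType")]
HB.structure Definition CompleteMetric (K : numDomainType) :=
  {M of Metric K M & Complete M}.

Section hausdorff_distance.
Context {R : realType} {X : metricType R}.
Implicit Types (x y : X) (A B C : set X).

Definition set_dist x B : R := inf [set mdist x y | y in B].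

Definition excess A B : R := sup [set set_dist x B | x in A].

Definition hausdorff_dist A B : R := Num.max (excess A B) (excess B A).

Lemma set_dist_has_lbound x B : has_lbound [set mdist x y | y in B].
Proof. by exists 0 => _ [y _ <-]; exact: mdist_ge0. Qed.

Lemma set_dist_le x y B : B y -> set_dist x B <= mdist x y.
Proof. by move=> By; apply: ge_inf; [exact: set_dist_has_lbound|exists y]. Qed.

Lemma le_set_dist x B (e : R) : B !=set0 ->
  (forall y, B y -> e <= mdist x y) -> e <= set_dist x B.
Proof.
by move=> B0 le_e; apply: lb_le_inf => [|_ [y By <-]];
  [exact: image_nonempty|exact: le_e].
Qed.

Lemma set_dist_ge0 x B : B !=set0 -> 0 <= set_dist x B.
Proof. by move=> B0; apply: le_set_dist => // y _; exact: mdist_ge0. Qed.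

Lemma set_dist_triangle x y B : B !=set0 ->
  set_dist x B <= mdist x y + set_dist y B.
Proof.
move=> B0; rewrite -lerBlDl; apply: le_set_dist => // z Bz.
by rewrite lerBlDl (le_trans (set_dist_le x Bz))// metric_triangle.
Qed.

Lemma set_dist_eq0 x B : B !=set0 -> closed B -> set_dist x B = 0 -> B x.
Proof.
move=> B0 cB dx0; apply: cB => U /metricType_numDomainType.nbhs_mdistP[e /= e0 eU].
have : has_inf [set mdist x y | y in B].
  by split; [exact: image_nonempty|exact: set_dist_has_lbound].
move=> /(inf_adherent e0)[_ [y By <-]]; rewrite -/(set_dist x B) dx0 add0r => xye.
by exists y; split => //; exact: eU.
Qed.

Lemma mdist_continuous x : continuous (mdist x).
Proof.
move=> y; apply/cvgrPdist_lt => e e0.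
have : \forall z \near y, mdist y z < e.
  exact: (metricType_numDomainType.cvgr_dist_lt (@cvg_id _ (nbhs y)) e0).
apply: filterS => z /= yze.
apply: le_lt_trans yze; rewrite ler_norml; apply/andP; split.
  by rewrite lerNl opprB lerBlDr addrC metric_triangle.
by rewrite lerBlDl (metric_sym y z) metric_triangle.
Qed.

Lemma excess_has_ubound A B : A !=set0 -> compact A -> B !=set0 ->
  has_ubound [set set_dist x B | x in A].
Proof.
move=> A0 cA [b Bb].
have [|c _ cmax] := compact_EVT_max (f := mdist b) A0 cA.
  exact/continuous_subspaceT/mdist_continuous.
exists (mdist b c) => _ [x Ax <-]; apply: le_trans (set_dist_le x Bb) _.
by rewrite metric_sym cmax// inE.
Qed.

Lemma le_excess A B x : A !=set0 -> compact A -> B !=set0 -> A x ->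
  set_dist x B <= excess A B.
Proof.
move=> A0 cA B0 Ax; apply: ub_le_sup; last by exists x.
exact: excess_has_ubound.
Qed.

Lemma excess_le A B (e : R) : A !=set0 ->
  (forall x, A x -> set_dist x B <= e) -> excess A B <= e.
Proof.
by move=> A0 le_e; apply: ge_sup => [|_ [x Ax <-]];
  [exact: image_nonempty|exact: le_e].
Qed.

Lemma excess_ge0 A B : A !=set0 -> compact A -> B !=set0 -> 0 <= excess A B.
Proof.
move=> A0 cA B0; have [x Ax] := A0.
exact: le_trans (set_dist_ge0 x B0) (le_excess A0 cA B0 Ax).
Qed.

Lemma excess_triangle A B C : A !=set0 -> compact A -> B !=set0 -> compact B ->
  C !=set0 -> excess A C <= excess A B + excess B C.
Proof.
move=> A0 cA B0 cB C0; apply: excess_le => // x Ax.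
rewrite -lerBlDr; apply: le_trans (le_excess A0 cA B0 Ax).
apply: le_set_dist => // y By; rewrite lerBlDr.
apply: le_trans (set_dist_triangle x y C0) _.
by rewrite lerD2l le_excess.
Qed.

Lemma excess_eq0 A B : A !=set0 -> compact A -> B !=set0 -> compact B ->
  excess A B <= 0 -> A `<=` B.
Proof.
move=> A0 cA B0 cB AB0 x Ax; apply: set_dist_eq0 => //.
  exact: compact_closed (metric_hausdorff (T := X)) cB.
apply/eqP; rewrite eq_le set_dist_ge0// andbT.
exact: le_trans (le_excess A0 cA B0 Ax) AB0.
Qed.

Lemma excessxx A : A !=set0 -> compact A -> excess A A = 0.
Proof.
move=> A0 cA; apply/eqP; rewrite eq_le excess_ge0// andbT.
by apply: excess_le => // x Ax; rewrite -(mdistxx x) set_dist_le.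
Qed.

End hausdorff_distance.

Record compacts (X : topologicalType) := Compacts {
  compacts_set :> set X ;
  compacts_nonempty : compacts_set !=set0 ;
  compacts_compact : compact compacts_set }.

Lemma compacts_inj (X : topologicalType) : injective (@compacts_set X).
Proof.
move=> [A A0 cA] [B B0 cB] /= AB; case: B / AB in B0 cB *.
by rewrite (Prop_irrelevance A0 B0) (Prop_irrelevance cA cB).
Qed.

HB.instance Definition _ (X : topologicalType) := gen_eqMixin (compacts X).
HB.instance Definition _ (X : topologicalType) := gen_choiceMixin (compacts X).

Section compacts_metric.
Context {R : realType} {X : metricType R}.
Implicit Types A B C : compacts X.

Let dH A B : R := hausdorff_dist A B.

Let dHxx A : dH A A = 0.
Proof.
rewrite /dH /hausdorff_dist maxxx excessxx//.
- exact: compacts_nonempty.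
- exact: compacts_compact.
Qed.

Let dH_positivity A B : dH A B = 0 -> A = B.
Proof.
case: A B => [A A0 cA] [B B0 cB]; rewrite /dH /hausdorff_dist/= => AB.
apply: compacts_inj => /=; apply/seteqP; split; apply: excess_eq0 => //.
- by rewrite -AB le_max lexx.
- by rewrite -AB le_max lexx orbT.
Qed.

Let dH_sym A B : dH A B = dH B A.
Proof. by rewrite /dH /hausdorff_dist maxC. Qed.

Let dH_triangle B A C : dH A C <= dH A B + dH B C.
Proof.
case: A B C => [A A0 cA] [B B0 cB] [C C0 cC]; rewrite /dH /hausdorff_dist/=.
rewrite ge_max; apply/andP; split.
  apply: le_trans (excess_triangle A0 cA B0 cB C0) _.
  by rewrite lerD// le_max lexx.
apply: le_trans (excess_triangle C0 cC B0 cB A0) _.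
by rewrite addrC lerD// le_max lexx orbT.
Qed.

HB.instance Definition _ := @isMetric.Build R (compacts X)
  dH dHxx dH_positivity dH_sym dH_triangle.

Lemma mdist_compactsE A B : mdist A B = hausdorff_dist A B.
Proof. by []. Qed.

End compacts_metric.

HB.instance Definition _ (R : realType) (X : pmetricType R) :=
  isPointed.Build (compacts X)
    (Compacts (ex_intro _ point (erefl point)) (@compact_set1 X point)).

Section metric_valued.
Context {R : realType} {M : pmetricType R}.
Implicit Types (h : R -> M) (g : R -> R) (a b alpha L : R).

(* A map on [a, b] is a total function on R of which only the values on [a, b]
   matter: the right limits below are taken at points tau < b.
   [mvariation] and [mtotal_variation] are metric-valued analogues of
   the library's real-valued [variation] and [total_variation]. *)
Definition mvariation a b h (s : seq R) : R :=
  let H := h \o nth b (a :: s) in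
  \sum_(0 <= n < size s) mdist (H n) (H n.+1).

Definition mtotal_variation a b h : \bar R :=
  ereal_sup [set (mvariation a b h s)%:E | s in itv_partition a b].

Definition holder_const a b g alpha h : set R :=
  [set L | 0 <= L /\ {in `[a, b] &, forall s t,
             mdist (h s) (h t) <= L * `|g t - g s| `^ alpha}].

Definition holder a b g alpha h := holder_const a b g alpha h !=set0.

(* The infimum is attained when [h] is Hoelder. *)
Definition holder_seminorm a b g alpha h : R := inf (holder_const a b g alpha h).

Definition jump h (tau : R) : R := mdist (lim (h r @[r --> tau^'+])) (h tau).

Definition jump_set a b h : set R :=
  [set tau | a <= tau < b /\ lim (h r @[r --> tau^'+]) <> h tau].

End metric_valued.

Section real_valued.
Context {R : realType}.
Implicit Types (g : R -> R) (a b : R).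

Definition right_jump g (tau : R) : R := lim (g r @[r --> tau^'+]) - g tau.

Definition pos_jump_set a b g : set R :=
  [set tau | a <= tau < b /\ 0 < right_jump g tau].

End real_valued.

(* Main.v *)
(* The right limits of f and F exist by completeness: beyond tau the oscillation
   on ]tau, r] is at most phi r = L (g r - g(tau+))^alpha, which tends to 0.
   For F this needs the space of compact sets to be complete for the Hausdorff
   distance. In a partition of [tau, r] only the first step sees the jump at
   tau, so V_H(F; [tau, r]) <= J_F(tau) + 2 phi r; letting r decrease to tau in
   d(f tau, f r) <= V_H(F; [tau, r]) gives J_f(tau) <= J_F(tau). *)

Require Import Defs.
From HB Require Import structures.
From mathcomp Require Import all_boot all_order all_algebra.
From mathcomp Require Import all_classical all_reals all_analysis.
Import Order.TTheory GRing.Theory Num.Theory.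
Import numFieldNormedType.Exports.
Local Open Scope classical_set_scope.
Local Open Scope ring_scope.

(** * Distances from points to compact sets *)

Section hausdorff_estimates.
Context {R : realType} {X : metricType R}.
Implicit Types (x y : X) (A B : compacts X).

Lemma set_dist_lt_ex x (B : set X) (e : R) : B !=set0 -> set_dist x B < e ->
  exists2 y, B y & mdist x y < e.
Proof.
move=> B0 xBe; apply/not_exists2P => h; move: xBe; apply/negP; rewrite -leNgt.
apply: le_set_dist => // y By; rewrite leNgt; apply/negP => xye.
by have [] := h y.
Qed.

Lemma set_dist_hausdorff x A B : set_dist x B <= set_dist x A + mdist A B.
Proof.
have A0 := compacts_nonempty A; have B0 := compacts_nonempty B.
rewrite -lerBlDr; apply: le_set_dist => // y Ay; rewrite lerBlDr.
apply: le_trans (set_dist_triangle x y B0) _; rewrite lerD2l mdist_compactsE.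
by rewrite le_max le_excess//; exact: compacts_compact.
Qed.

Lemma set_dist_le_mdist x A B : (A : set X) x -> set_dist x B <= mdist A B.
Proof.
move=> Ax; rewrite mdist_compactsE le_max le_excess//.
- exact: compacts_nonempty.
- exact: compacts_compact.
- exact: compacts_nonempty.
Qed.

End hausdorff_estimates.

(** * Completeness of the space of compact sets under the Hausdorff distance *)

Section compacts_complete.
Context {R : realType} {X : completeMetricType R}.
Implicit Types (x y : X) (A B C : compacts X).

(* A nearest-point projection sends [G] to a filter on the compact set [A], and
   a ball around a cluster point of the image pulls back to a small set of [G]. *)
Lemma ultra_near_compacts_cvg (G : set_system X) : UltraFilter G ->
  (forall e : R, 0 < e ->
    exists A : compacts X, \forall x \near G, set_dist x A < e) ->
  exists x, G --> x.
Proof.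
move=> UG tbG; suff : cvg G by move=> /cvg_ex.
apply: cauchy_cvg; apply/cauchy_exP => e e0.
have [A GA] := tbG (e / 2) ltac:(by rewrite divr_gt0).
have /choice[p pP] : forall x, exists y, (A : set X) y /\
    (set_dist x A < e / 2 -> mdist x y < e / 2).
  move=> x; case: (boolP (set_dist x A < e / 2)) => [xA|_].
    by have [y Ay xy] := set_dist_lt_ex _ _ _ (compacts_nonempty A) xA; exists y.
  by have [y Ay] := compacts_nonempty A; exists y.
have pGF := fmap_proper_filter p (@ultra_proper _ _ UG).
have [|q [Aq clq]] := compacts_compact (c := A) pGF.
  by apply: (@filterE _ G) => x; case: (pP x).
exists q; rewrite ballEmdist.
(* The ultrafilter contains the [e]-ball about [q] or its complement. In the second case, clustering
   at [q] yields an [x] outside that ball with [p x] within [e / 2] of both [q] and [x], which is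
   absurd. *)
have [//|Gc] := in_ultra_setVsetC [set x | mdist q x < e] UG.
have pG : (p @ G) (p @` [set x | set_dist x A < e / 2 /\ ~ mdist q x < e]).
  rewrite /nbhs/=; near=> x; exists x => //; split; near: x; first exact: GA.
  exact: Gc.
have bq : nbhs q [set y | mdist q y < e / 2].
  apply/metricType_numDomainType.nbhs_mdistP.
  by exists (e / 2) => //=; rewrite divr_gt0.
have [_ [[x [xA +] <-] /= qx]] := clq _ _ pG bq.
case; apply: le_lt_trans (metric_triangle q (p x) x) _.
rewrite (splitr e) ltrD// metric_sym; exact: (pP x).2.
Unshelve. all: by end_near. Qed.

Section limit_set.
Variable Phi : set_system (compacts X).
Hypothesis PhiF : ProperFilter Phi.
Hypothesis cauchyPhi : cauchy Phi.

Let near_Phi (e : R) : 0 < e -> exists A, Phi [set B | mdist A B < e].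
Proof.
move=> e0; have /cauchyP/(_ e e0)[A] := cauchyPhi.
by rewrite ballEmdist; exists A.
Qed.

(** The candidate limit of [Phi]: the Kuratowski lower limit, made of the points whose distance to
    [A] tends to 0 along [Phi]. *)
Let K : set X :=
  [set x | forall e : R, 0 < e -> Phi [set A : compacts X | set_dist x A < e]].

Let K_le x A (e : R) : K x -> Phi [set B | mdist A B < e] -> set_dist x A <= e.
Proof.
move=> Kx PhiA; apply/ler_addgt0Pl => d d0.
have [B [xB AB]] := filter_ex (filterI (Kx d d0) PhiA).
apply: le_trans (set_dist_hausdorff x B A) _.
by rewrite lerD// ltW// metric_sym.
Qed.

(** The source of points of [K], serving both its compactness and the approximation of points by
    [K]. Such a [G] lies near compact sets at every scale, so it converges, and its limit inherits
    the small distances. *)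
Let K_ultra (G : set_system X) : UltraFilter G ->
  (forall e : R, 0 < e ->
    Phi [set A : compacts X | \forall x \near G, set_dist x A < e]) ->
  exists2 x, K x & G --> x.
Proof.
move=> UG GPhi; have [|x Gx] := @ultra_near_compacts_cvg G UG.
  by move=> e /GPhi/filter_ex.
exists x => // e e0.
have e20 : 0 < e / 2 by rewrite divr_gt0.
apply: filterS (GPhi _ e20) => A GA.
have /metricType_numDomainType.fcvgrPdist_lt/(_ _ e20) Gxe := Gx.
have [y [xy yA]] := filter_ex (filterI Gxe GA).
apply: le_lt_trans (set_dist_triangle x y (compacts_nonempty A)) _.
by rewrite (splitr e) ltrD.
Qed.

(** Choose in each [B] close to [A] a point within [e] of [y], push [Phi] forward along this choice
    and refine to an ultrafilter: its limit is the required point. The strict bound becomes a weak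
    one in the limit. *)
Let K_approx A y (e : R) : Phi [set B | mdist A B < e] -> (A : set X) y ->
  exists2 x, K x & mdist y x <= e.
Proof.
move=> PhiA Ay.
have /choice[s sP] : forall B, exists z, (B : set X) z /\
    (mdist A B < e -> mdist y z < e).
  move=> B; case: (boolP (mdist A B < e)) => [AB|_].
    have yB := le_lt_trans (set_dist_le_mdist y A B Ay) AB.
    by have [z Bz yz] := set_dist_lt_ex _ _ _ (compacts_nonempty B) yB; exists z.
  by have [z Bz] := compacts_nonempty B; exists z.
have [G [UG sG]] := ultraFilterLemma (fmap_proper_filter s PhiF).
have [d d0|x Kx Gx] := K_ultra G UG.
  (* Two sets within [d / 2] of [C] are within [d] of each other, so [s B'] lies within [d] of
     [B]. *)
  have [C PhiC] := near_Phi (d / 2) ltac:(by rewrite divr_gt0).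
  apply: filterS (PhiC) => B CB; apply: sG; rewrite /nbhs/=.
  apply: filterS (PhiC) => B' CB' /=.
  apply: le_lt_trans (set_dist_le_mdist _ _ _ (sP B').1) _.
  apply: le_lt_trans (metric_triangle B' C B) _.
  by rewrite (splitr d) ltrD// metric_sym.
exists x => //; apply/ler_addgt0Pl => d d0.
have /metricType_numDomainType.fcvgrPdist_lt/(_ _ d0) Gxd := Gx.
have Gy : G [set z | mdist y z < e].
  by apply: sG; rewrite /nbhs/=; apply: filterS PhiA => B; exact: (sP B).2.
have [z [xz yz]] := filter_ex (filterI Gxd Gy).
apply: le_trans (metric_triangle y z x) _.
by rewrite addrC lerD// ltW// metric_sym.
Qed.

Let K_nonempty : K !=set0.
Proof.
have [A PhiA] := near_Phi 1 ltr01; have [y Ay] := compacts_nonempty A.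
by have [x Kx _] := K_approx _ _ _ PhiA Ay; exists x.
Qed.

Let K_compact : compact K.
Proof.
rewrite compact_ultra => G UG GK.
have [e e0|x Kx Gx] := K_ultra G UG; last by exists x.
have e20 : 0 < e / 2 by rewrite divr_gt0.
(* A quarter of [e] makes two sets close to [C] lie within [e / 2] of each other; [K_le] then gives
   a weak bound by [e / 2], hence a strict one by [e]. *)
have e40 : 0 < e / 2 / 2 by rewrite divr_gt0.
have [C PhiC] := near_Phi _ e40.
apply: filterS (PhiC) => A CA; apply: filterS GK => x Kx.
have : Phi [set B | mdist A B < e / 2].
  apply: filterS (PhiC) => B CB; apply: le_lt_trans (metric_triangle A C B) _.
  by rewrite (splitr (e / 2)) ltrD// metric_sym.
move=> /(K_le _ _ _ Kx)/le_lt_trans; apply.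
by rewrite gtr_pMr// invf_lt1// ltr1n.
Qed.

(** The limit is [K]: [K_le] and [K_approx] bound the two excesses between [K] and a set [A] that is
    close to most of [Phi]. *)
Lemma compacts_cauchy_cvg : cvg Phi.
Proof.
apply/cvg_ex; exists (Compacts K_nonempty K_compact).
apply/metricType_numDomainType.fcvgrPdist_lt => e e0.
have e20 : 0 < e / 2 by rewrite divr_gt0.
have [A PhiA] := near_Phi _ e20.
apply: filterS (PhiA) => B AB; apply: le_lt_trans (metric_triangle _ A _) _.
rewrite (splitr e) ler_ltD// mdist_compactsE ge_max; apply/andP; split.
  by apply: excess_le => // x Kx; exact: K_le.
apply: excess_le => [|y Ay]; first exact: compacts_nonempty.
have [x Kx yx] := K_approx _ _ _ PhiA Ay.
exact: le_trans (set_dist_le y Kx) yx.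
Qed.

End limit_set.

End compacts_complete.

(** With this instance one Cauchy argument serves both the set-valued [F] and the point-valued
    [f]. *)
HB.instance Definition _ (R : realType) (X : completeMetricType R) :=
  Uniform_isComplete.Build (compacts X) (@compacts_cauchy_cvg R X).

(** * Powers of limits and right limits of monotone functions *)

Section right_limits.
Context {R : realType}.
Implicit Types (tau b p : R) (g : R -> R).

(** At [l > 0] the power function is differentiable, hence continuous; [l = 0] is done by hand,
    using that [u] is eventually nonnegative. *)
Lemma cvg_powR {T : Type} {F : set_system T} {FF : ProperFilter F}
    (u : T -> R) (l p : R) : 0 < p -> (\forall t \near F, 0 <= u t) ->
  u t @[t --> F] --> l -> u t `^ p @[t --> F] --> l `^ p.
Proof.
move=> p0 u0 ul.
have : 0 <= l by rewrite -(cvg_lim _ ul)//; apply: limr_ge => //; exact: cvgP ul.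
rewrite le_eqVlt => /predU1P[l0|l0]; last first.
  apply: (cvg_comp u (fun x => x `^ p) ul).
  have dl : derivable (fun x : R => x `^ p) l 1.
    exact: (@ex_derive _ _ _ _ _ _ _ (is_derive1_powR p l0)).
  exact: (differentiable_continuous ((derivable1_diffP _ _).1 dl)).
rewrite -l0 in ul *; rewrite powR0 ?gt_eqF//; apply/cvgrPdist_lt => e e0.
near=> t; rewrite sub0r normrN ger0_norm ?powR_ge0//.
(* Threshold for [u]: by monotonicity of the power, [u t] below the [p]-th root of [e] suffices. *)
have -> : e = (e `^ p^-1) `^ p by rewrite -powRrM mulVf ?gt_eqF// powRr1// ltW.
have ut0 : 0 <= u t by near: t.
apply: gt0_ltr_powR => //; rewrite ?nnegrE ?powR_ge0//.
by near: t; apply: cvgr_lt ul _ _; exact: powR_gt0.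
Unshelve. all: by end_near. Qed.

(** The right limit is the infimum of [g] over the half-open interval to the right of [tau], for
    which [g tau] is a lower bound. *)
Lemma nondecreasing_right_limit g tau b : tau < b ->
    {in `[tau, b] &, nondecreasing_fun g} ->
  [/\ cvg (g r @[r --> tau^'+]), g tau <= lim (g r @[r --> tau^'+])
    & forall r, tau < r <= b -> lim (g r @[r --> tau^'+]) <= g r].
Proof.
move=> tb gmono.
have tauI : tau \in `[tau, b] by rewrite in_itv/= lexx ltW.
have sub r : r \in `]tau, b] -> r \in `[tau, b].
  by rewrite !in_itv/= => /andP[/ltW-> ->].
have lbg : lbound (g @` [set` `]tau, b]]) (g tau).
  move=> _ [r /= rI <-]; apply: gmono => //; first exact: sub.
  by move: rI; rewrite in_itv/= => /andP[/ltW].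
have gcvg : g r @[r --> tau^'+] --> inf (g @` [set` `]tau, b]]).
  apply: nondecreasing_at_right_cvgr; first by rewrite bnd_simp.
    by move=> x y xI yI; apply: gmono; exact: sub.
  by exists (g tau).
rewrite (cvg_lim _ gcvg)//; split; first exact: gcvg.
  apply: lb_le_inf lbg; exists (g b), b => //=.
  by rewrite in_itv/= tb lexx.
move=> r rI; apply: ge_inf; first by exists (g tau).
by exists r => //=; rewrite in_itv.
Qed.

End right_limits.

(** * Total variation of metric-valued maps *)

Section metric_variation.
Context {R : realType} {M : pmetricType R}.
Implicit Types (h : R -> M) (s t b C : R).

Lemma mvariation_cons t b h x (s : seq R) :
  mvariation t b h (x :: s) = mdist (h t) (h x) + mvariation x b h s.
Proof. by rewrite /mvariation/= big_nat_recl. Qed.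

Lemma mdist_le_mtotal_variation h s t : s < t ->
  ((mdist (h s) (h t))%:E <= mtotal_variation s t h)%E.
Proof.
move=> st; apply: ereal_sup_ubound; exists [:: t]; first exact: itv_partition1.
by rewrite mvariation_cons /mvariation/= big_geq// addr0.
Qed.

(** Every partition is a first step out of [s] followed by a partition of what remains; bounding the
    two separately isolates a jump at [s]. *)
Lemma mtotal_variation_le_first h s b (A C : R) : s < b -> 0 <= C ->
    (forall t, s < t <= b -> mdist (h s) (h t) <= A) ->
    (forall t, s < t < b -> (mtotal_variation t b h <= C%:E)%E) ->
  (mtotal_variation s b h <= (A + C)%:E)%E.
Proof.
move=> sb C0 hA hC; apply: ge_ereal_sup => _ [[|t l] lP <-].
  by move: sb; rewrite (itv_partition_nil lP) ltxx.
have tlP := itv_partition_cons lP; have tb := itv_partition_le tlP.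
have st : s < t by case: lP => /= /andP[].
rewrite lee_fin mvariation_cons lerD ?hA ?st//.
(* If the first step already reaches [b], the remaining sum is empty and [0 <= C] covers it. *)
move: tb; rewrite le_eqVlt => /predU1P[tb|tb].
  rewrite tb in tlP *; rewrite (itv_partitionxx tlP).
  by rewrite /mvariation/= big_geq.
rewrite -lee_fin; apply: le_trans (hC t _); last by rewrite st.
by apply: ereal_sup_ubound; exists l.
Qed.

Lemma mdist_le_lim h tau x (A : R) :
    cvg (h r @[r --> tau^'+]) ->
    (\forall r \near tau^'+, mdist (h r) x <= A) ->
  mdist (lim (h r @[r --> tau^'+])) x <= A.
Proof.
move=> hcvg hA; apply/ler_addgt0Pl => e e0.
near tau^'+ => r.
apply: le_trans (metric_triangle _ (h r) x) _; apply: lerD; near: r; last first.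
  exact: hA.
exact: metricType_numDomainType.cvgr_dist_le.
Unshelve. all: by end_near. Qed.

End metric_variation.

(** * Right limits and jumps of Hölder maps at a fixed point *)

Section holder_right_limit.
Context {R : realType} (tau b : R) (g : R -> R) (alpha L : R).
Hypotheses (tb : tau < b) (gmono : {in `[tau, b] &, nondecreasing_fun g}).
Hypotheses (alpha0 : 0 < alpha) (L0 : 0 <= L).

Let gl := lim (g r @[r --> tau^'+]).

Let gcvg : g r @[r --> tau^'+] --> gl.
Proof. by case: (nondecreasing_right_limit _ _ _ tb gmono). Qed.

Let gl_ge : g tau <= gl.
Proof. by case: (nondecreasing_right_limit _ _ _ tb gmono). Qed.

Let gl_le r : tau < r -> r <= b -> gl <= g r.
Proof.
move=> tr rb; case: (nondecreasing_right_limit _ _ _ tb gmono) => _ _; apply.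
by rewrite tr.
Qed.

Let g_le s t : tau <= s -> s <= t -> t <= b -> g s <= g t.
Proof.
move=> ts st tb'; apply: gmono => //; rewrite in_itv/=.
  by rewrite ts (le_trans st).
by rewrite tb' (le_trans ts).
Qed.

Let near_itv : \forall r \near tau^'+, tau < r <= b.
Proof.
near=> r; apply/andP; split; near: r; first exact: nbhs_right_gt.
exact: nbhs_right_le.
Unshelve. all: by end_near. Qed.

(** Measured from the right limit [gl] instead of [g tau], so that it tends to 0 even where [g]
    jumps. *)
Let phi r := L * (g r - gl) `^ alpha.

Let phi_ge0 r : 0 <= phi r. Proof. by rewrite mulr_ge0// powR_ge0. Qed.

Let phi_lt (e : R) : 0 < e -> \forall r \near tau^'+, phi r < e.
Proof.
suff : phi r @[r --> tau^'+] --> 0 by move=> + e0; move/cvgr_lt; apply.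
rewrite -(mulr0 L); apply: cvgMr.
rewrite -(@powR0 R alpha) ?gt_eqF//; apply: cvg_powR => //.
  by apply: filterS near_itv => r /andP[tr rb]; rewrite subr_ge0 gl_le.
by rewrite -(subrr gl); apply: cvgB => //; exact: cvg_cst.
Qed.

Let powR_le_phi s t : tau < s -> s <= t -> t <= b ->
  L * `|g t - g s| `^ alpha <= phi t.
Proof.
move=> ts st tb'; have gst : g s <= g t by rewrite g_le// ltW.
rewrite ger0_norm ?subr_ge0// /phi ler_wpM2l//.
apply: ge0_ler_powR; first exact: ltW.
- by rewrite nnegrE subr_ge0.
- by rewrite nnegrE subr_ge0 gl_le// (lt_le_trans ts).
- by rewrite lerD2l lerN2 gl_le// (le_trans st).
Qed.

(** Cauchy criterion with centre [h r], where [phi r < e]: only increments strictly to the right of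
    [tau] enter, so a jump of [g] at [tau] does no harm. *)
Lemma holder_right_cvg (M : completeMetricType R) (h : R -> M) :
    (forall s t, tau < s -> s < t -> t <= b ->
      mdist (h s) (h t) <= L * `|g t - g s| `^ alpha) ->
  cvg (h r @[r --> tau^'+]).
Proof.
move=> hh; apply: cauchy_cvg; apply/cauchy_exP => e e0.
near tau^'+ => r; have re : phi r < e by near: r; exact: phi_lt.
have /andP[tr rb] : tau < r <= b by near: r; exact: near_itv.
exists (h r); rewrite ballEmdist /nbhs/=; near=> s => /=.
have ts : tau < s by near: s; exact: nbhs_right_gt.
have sr : s < r by near: s; exact: nbhs_right_lt.
rewrite metric_sym; apply: le_lt_trans re.
by apply: le_trans (hh _ _ ts sr rb) _; rewrite powR_le_phi// ltW.
Unshelve. all: by end_near. Qed.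

Section jump_bounds.
Context {M : pmetricType R} (h : R -> M).
Hypothesis hcvg : cvg (h r @[r --> tau^'+]).
Hypothesis hV : forall s t, tau <= s -> s < t -> t <= b ->
  (mtotal_variation s t h <= (L * `|g t - g s| `^ alpha)%:E)%E.

Let hh s t : tau <= s -> s < t -> t <= b ->
  mdist (h s) (h t) <= L * `|g t - g s| `^ alpha.
Proof.
move=> ts st tb'; rewrite -lee_fin.
exact: le_trans (mdist_le_mtotal_variation _ _ _ st) (hV _ _ ts st tb').
Qed.

(** Let [r] decrease to [tau] in the Hölder bound for the increment from [tau] to [r]. *)
Lemma jump_le_holder : jump h tau <= L * right_jump g tau `^ alpha.
Proof.
apply/ler_addgt0Pl => e e0.
have hl : L * (g r - g tau) `^ alpha @[r --> tau^'+] -->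
    L * right_jump g tau `^ alpha.
  apply: cvgMr; apply: cvg_powR => //.
    apply: filterS near_itv => r /andP[tr rb]; rewrite subr_ge0.
    by rewrite g_le// ltW.
  by apply: cvgB => //; exact: cvg_cst.
rewrite addrC; apply: mdist_le_lim => //; near=> r.
have /andP[tr rb] : tau < r <= b by near: r; exact: near_itv.
rewrite metric_sym; apply: le_trans (hh _ _ (lexx _) tr rb) _.
rewrite ger0_norm ?subr_ge0 ?g_le ?(ltW tr)//.
by near: r; apply: (cvgr_le _ hl); rewrite ltrDl.
Unshelve. all: by end_near. Qed.

(** One [phi r] pays for the way from the right limit of [h] to the first partition point, the other
    for the variation after that point. *)
Lemma mtotal_variation_right_le r : tau < r <= b ->
  (mtotal_variation tau r h <= (jump h tau + phi r + phi r)%:E)%E.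
Proof.
move=> /andP[tr rb]; apply: mtotal_variation_le_first => // t /andP[tt' tr'].
  rewrite metric_sym.
  apply: le_trans (metric_triangle _ (lim (h r @[r --> tau^'+])) _) _.
  rewrite -/(jump h tau) addrC lerD2l metric_sym.
  (* The distance from the right limit to [h t] is a limit of increments from [s] to [t], each at
     most [phi t], hence at most [phi r]. *)
  apply: mdist_le_lim => //; near=> s.
  have ts : tau < s by near: s; exact: nbhs_right_gt.
  have st : s < t by near: s; exact: nbhs_right_lt.
  apply: le_trans (hh _ _ (ltW ts) st (le_trans tr' rb)) _.
  apply: le_trans (powR_le_phi _ _ ts (ltW st) (le_trans tr' rb)) _.
  rewrite /phi ler_wpM2l//; apply: ge0_ler_powR; first exact: ltW.
  - by rewrite nnegrE subr_ge0 gl_le// (le_trans tr').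
  - by rewrite nnegrE subr_ge0 gl_le.
  - by rewrite lerD2r g_le// ltW.
apply: le_trans (hV _ _ (ltW tt') tr' rb) _.
by rewrite lee_fin powR_le_phi// ltW.
Unshelve. all: by end_near. Qed.

Lemma jump_le_jump (N : pmetricType R) (k : R -> N) :
    cvg (k r @[r --> tau^'+]) ->
    (forall t, tau < t <= b ->
      ((mdist (k tau) (k t))%:E <= mtotal_variation tau t h)%E) ->
  jump k tau <= jump h tau.
Proof.
move=> kcvg kV; apply/ler_addgt0Pl => e e0.
rewrite addrC; apply: mdist_le_lim => //; near=> r.
have rI : tau < r <= b by near: r; exact: near_itv.
rewrite metric_sym -lee_fin; apply: le_trans (kV _ rI) _.
apply: le_trans (mtotal_variation_right_le _ rI) _.
(* Close to [tau], each of the two copies of [phi r] is below [e / 2]. *)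
rewrite lee_fin -addrA lerD2l (splitr e) lerD// ltW//; near: r; apply: phi_lt.
all: by rewrite divr_gt0.
Unshelve. all: by end_near. Qed.

End jump_bounds.

End holder_right_limit.

(** * Jumps of the multifunction and of its selection *)

Lemma holder_seminorm_ge0 {R : realType} {M : pmetricType R} (a b : R)
    (g : R -> R) (alpha : R) (h : R -> M) :
  holder a b g alpha h -> 0 <= holder_seminorm a b g alpha h.
Proof. by move=> hh; apply: lb_le_inf => // L []. Qed.

Theorem corollary9p6 (R : realType) (X : completeMetricType R) (a b : R)
  (g : R -> R) (alpha : R) (F : R -> compacts X)
  (theta : R) (xtheta : X) (f : R -> X)
  (hab : a <= b)
  (g_left_cont : forall t, a < t <= b -> g r @[r --> t^'-] --> g t)
  (g_nondecr : {in `[a, b] &, nondecreasing_fun g})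
  (alpha_gt1 : 1 < alpha)
  (F_holder : holder a b g alpha F)
  (theta_in : a <= theta <= b)
  (xtheta_in : (F theta : set X) xtheta)
  (f_sel : forall t, a <= t <= b -> (F t : set X) (f t))
  (f_theta : f theta = xtheta)
  (f_le : forall s t, a <= s -> s < t -> t <= b ->
    [/\ ((mdist (f s) (f t))%:E <= mtotal_variation s t F)%E,
        (mtotal_variation s t F <=
          (holder_seminorm a b g alpha F * `|g t - g s| `^ alpha)%:E)%E
      & (mtotal_variation s t f <= mtotal_variation s t F)%E]) :
  [/\ forall tau, a <= tau < b ->
        [/\ cvg (g r @[r --> tau^'+]),
            cvg (F r @[r --> tau^'+]) & cvg (f r @[r --> tau^'+])],
      forall tau, a <= tau < b ->
        jump f tau <= jump F tau
          <= holder_seminorm a b g alpha F * right_jump g tau `^ alpha,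
      jump_set a b f `<=` jump_set a b F
    & jump_set a b F `<=` pos_jump_set a b g].
Proof.
have L0 := holder_seminorm_ge0 _ _ _ _ _ F_holder.
have alpha0 : 0 < alpha by exact: lt_trans alpha_gt1.
have gm tau : a <= tau -> {in `[tau, b] &, nondecreasing_fun g}.
  move=> atau s t sI tI; apply: g_nondecr; [move: sI|move: tI];
    by apply: subitvPl; rewrite bnd_simp.
have FV tau s t : a <= tau -> tau <= s -> s < t -> t <= b ->
    (mtotal_variation s t F <=
      (holder_seminorm a b g alpha F * `|g t - g s| `^ alpha)%:E)%E.
  by move=> atau taus st tb; case: (f_le s t (le_trans atau taus) st tb).
have cvgs tau : a <= tau < b ->
    [/\ cvg (g r @[r --> tau^'+]),
        cvg (F r @[r --> tau^'+]) & cvg (f r @[r --> tau^'+])].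
  move=> /andP[atau taub].
  have [gcvg _ _] := nondecreasing_right_limit _ _ _ taub (gm _ atau).
  split=> //;
    apply: (holder_right_cvg _ _ _ _ _ taub (gm _ atau) alpha0 L0) => s t ts st tb.
    rewrite -lee_fin; apply: le_trans (FV tau s t atau (ltW ts) st tb).
    exact: mdist_le_mtotal_variation.
  (* For [f] the Hölder bound passes through the variation of [F], which dominates its
     increments. *)
  have [fV _ _] := f_le s t (le_trans atau (ltW ts)) st tb.
  by rewrite -lee_fin; apply: le_trans fV (FV tau s t atau (ltW ts) st tb).
have jumps tau : a <= tau < b -> jump f tau <= jump F tau
    <= holder_seminorm a b g alpha F * right_jump g tau `^ alpha.
  move=> tauI; have [_ Fcvg fcvg] := cvgs tau tauI; case/andP: tauI => atau taub.
  have FVtau s t := FV tau s t atau.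
  apply/andP; split; last first.
    exact: (jump_le_holder _ _ _ _ _ taub (gm _ atau) alpha0 _ Fcvg FVtau).
  apply: (jump_le_jump _ _ _ _ _ taub (gm _ atau) alpha0 L0 _ Fcvg FVtau) => // t.
  by move=> /andP[taut tb]; have [] := f_le tau t atau taut tb.
split=> // tau [tauI neq]; split=> //; have /andP[jfF jFg] := jumps tau tauI.
  (* If [F] has no jump at [tau], then [jump F tau] is 0, which forces [jump f tau] to be 0. *)
  apply: contra_not neq => Feq; apply: (mdist_positivity (K := R)).
  apply/eqP; rewrite eq_le mdist_ge0 andbT.
  by apply: le_trans jfF _; rewrite /jump Feq mdistxx.
have [atau taub] := andP tauI.
have [_ gl_ge _] := nondecreasing_right_limit _ _ _ taub (gm _ atau).
rewrite lt_neqAle subr_ge0 gl_ge andbT eq_sym; apply/eqP => g0.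
(* Without a jump of [g] the bound is the seminorm times 0 to the power [alpha], which is 0 since
   [alpha] is nonzero. *)
apply: neq; apply: (mdist_positivity (K := R)); apply/eqP.
rewrite eq_le mdist_ge0 andbT; apply: le_trans jFg _.
by rewrite g0 powR0 ?mulr0// gt_eqF.
Qed.
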